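(* Let $p$ be an odd prime, $q=p^n\equiv 1\pmod 4$ and $q=4f+1$. Let $G=(\mathbb{F}_q,+)$ and let $w$ be a generator of $\mathbb{F}_q^*$, with cyclotomic classes $C_0,C_1,C_2,C_3$ of order $4$ defined from $w$. If $p\equiv -1\pmod 4$, let $s=(-p)^{n/2}$ and $t=0$. If $p\equiv 1\pmod 4$, let the integer $s$ be uniquely determined by $q=s^2+t^2$, $p\nmid s$, $s\equiv 1\pmod 4$, and let the integer $t$ be uniquely determined by $w^{(q-1)/4}\equiv s/t\pmod p$. (1) When $P=C_i$ and $N=G-C_i-C_j$ with $\{i,j\}\subset\{0,1,2,3\}$ and $i\neq j$, $D=P-N$ is a $\left(q,3f+1,\frac{f-1}{4}\right)$-signed difference set if and only if $f\equiv 1\pmod 4$ and $s,t$ satisfy one of the conditions: 1) $i-j\equiv 1\pmod 4$, $4t+3s=3$; 2) $i-j\equiv 2\pmod 4$, $s=9$; 3) $i-j\equiv 3\pmod 4$, $3s-4t=3$. (2) When $P=G-C_i-C_j-0_G$ and $N=C_i+0_G$ with $\{i,j\}\subset\{0,1,2,3\}$ and $i\neq j$, $D=P-N$ is a $\left(q,3f+1,\frac{f-5}{4}\right)$-signed difference set if and only if $f\equiv 1\pmod 4$ and $s,t$ satisfy one of the conditions: 1) $i-j\equiv 1\pmod 4$, $3s+4t=-5$; 2) $i-j\equiv 2\pmod 4$, $s=-15$; 3) $i-j\equiv 3\pmod 4$, $4t-3s=5$. (3) When $P=G-C_i-0_G$ and $N=0_G$ with $i\in\{0,1,2,3\}$,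 $D=P-N$ is a $\left(q,3f+1,\frac{9f-9}{4}\right)$-signed difference set if and only if $f\equiv 1\pmod 4$ and $s=-7$.
   Context: The cyclotomic classes of order $4$ are $C_0=\{w^{4j}:0\le j\le f-1\}$ and $C_i=w^iC_0$ for $0\le i\le 3$. In the case $p\equiv 1\pmod 4$, $q=s^2+t^2$ is a representation in integers with $p\nmid s$, $s\equiv 1\pmod 4$ (this fixes $s$ and $|t|$), and the sign of $t$ is fixed by requiring that $w^{(q-1)/4}$, which lies in the prime field $\mathbb{F}_p$, equals $s/t$ in $\mathbb{F}_p$. For $G=(\mathbb{F}_q,+)$ with identity $0_G$, a subset $S\subseteq G$ is identified with $\sum_{s\in S}s$ in the group ring $\mathbb{Z}[G]$; thus $C_i+0_G$, $G-C_i-C_j$, $G-C_i-C_j-0_G$ represent $C_i\cup\{0\}$, $G\setminus(C_i\cup C_j)$, $G\setminus(C_i\cup C_j\cup\{0\})$. For disjoint subsets $P,N$ of $G$, the element $D=P-N$ is a signed set of size $k=|P|+|N|$. For $A=\sum_g a_g g\in\mathbb{Z}[G]$, $A^{-1}=\sum_g a_g g^{-1}$ with $g^{-1}$ the inverse of $g$ in $G$ (i.e. the field element $-g$). $D$ is a $(q,k,\lambda)$-signed difference set if $DD^{-1}=\lambda G+(k-\lambda)\cdot 0_G$ in $\mathbb{Z}[G]$, where $\lambda$ is an integer. *)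

(* Defs.v *)
From mathcomp Require Import all_boot all_order all_algebra.
From mathcomp Require Import all_fingroup all_solvable.

Set Implicit Arguments.
Unset Strict Implicit.
Unset Printing Implicit Defensive.

Import Order.TTheory GRing.Theory Num.Theory.
Local Open Scope ring_scope.

(* The integral group ring Z[G] of a finite abelian group G written
   additively.  The element sum_g a_g g is the function g |-> a_g, so the
   additive structure is the library's pointwise one; the ring product is the
   convolution [gr_mul], not the pointwise product. *)
Notation group_ring G := {ffun G -> int}.

Definition gr_elt (G : finZmodType) (g : G) : group_ring G :=
  [ffun x => (x == g)%:R].

Definition gr_set (G : finZmodType) (S : {set G}) : group_ring G :=
  \sum_(g in S) gr_elt g.

Definition gr_mul (G : finZmodType) (A B : group_ring G) : group_ring G :=
  [ffun x => \sum_(g : G) A g * B (x - g)].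

(* A^{-1} = sum_g a_g (-g): the inverse of g in (G, +) is -g, and this is not
   a multiplicative inverse of A in Z[G]. *)
Definition gr_inv (G : finZmodType) (A : group_ring G) : group_ring G :=
  \sum_(g : G) gr_elt (- g) *~ A g.

(* D = P - N is a (v, k, lam)-signed difference set.  The parameter lam is
   given as a rational number because it occurs in the form (f - 1) / 4; being
   an integer is part of the definition. *)
Definition signed_difference_set (G : finZmodType) (P N : {set G})
    (v k : nat) (lam : rat) : Prop :=
  let D := gr_set P - gr_set N in
  [/\ #|G| = v, [disjoint P & N], (#|P| + #|N|)%N = k &
      exists2 l : int, lam = l%:~R &
        gr_mul D (gr_inv D) =
          gr_set [set: G] *~ l + gr_elt (0 : G) *~ (k%:Z - l)].

Definition cyclotomic_class0 (F : finFieldType) (w : {unit F}) (f : nat) :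
    {set F} :=
  [set val w ^+ (4 * j) | j : 'I_f].

Definition cyclotomic_class (F : finFieldType) (w : {unit F}) (f i : nat) :
    {set F} :=
  [set val w ^+ i * x | x in cyclotomic_class0 w f].

(* The normalised pair (s, t) attached to q = p ^ n and w.  In the second case
   w ^ ((q - 1) / 4) lies in the prime field, so that the congruence modulo p
   is an equality in F. *)
Definition quartic_parameters (F : finFieldType) (p n : nat) (w : {unit F})
    (s t : int) : Prop :=
  [/\ (p = 3 %[mod 4])%N -> s = (- p%:Z) ^+ (n %/ 2) /\ t = 0 &
      (p = 1 %[mod 4])%N ->
        [/\ (p ^ n)%N%:Z = s ^+ 2 + t ^+ 2,
            ~~ (p%:Z %| s)%Z,
            (s = 1 %[mod 4])%Z &
            val w ^+ ((p ^ n - 1) %/ 4) = s%:~R / t%:~R :> F]].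

(* Main.v *)
(* Each of the sets D is, on F \ {0}, a function of the quartic class alone, so
   its autocorrelation at y depends only on the class of y and is a quadratic
   form in the values of D whose matrix consists of the cyclotomic numbers of
   order 4.  Integrality of lambda forces f = 1 (mod 4); then q = 5 (mod 8),
   hence p = 1 (mod 4) and -1 lies in C_2.  The symmetries x -> 1 - x and
   x -> 1/x and the row sums express all cyclotomic numbers linearly in q and
   in the two coordinates of the quartic Jacobi sum K = a + ib.  One has
   a^2 + b^2 = q; replacing i by g = w^f and characters by powers gives
   a + bg = 0 and a - bg = +-C(2f, f) <> 0 in F.  Uniqueness of the
   representation of q as a sum of two squares then yields s = a, t = -b, and
   the theorem becomes linear arithmetic in q, s, t. *)
Require Import Defs.
From mathcomp Require Import all_boot all_order all_algebra.
From mathcomp Require Import all_fingroup all_solvable all_field.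
From mathcomp Require Import zify ring.

Set Implicit Arguments.
Unset Strict Implicit.
Unset Printing Implicit Defensive.

Import Order.TTheory GRing.Theory Num.Theory.
Local Open Scope ring_scope.

(** * Uniqueness of sums of two squares *)

Lemma sqr_sum_eq (q x y : int) :
  0 < q -> (q %| x)%Z -> x ^+ 2 + y ^+ 2 = q ^+ 2 ->
  (x = 0 /\ (y = q \/ y = - q)) \/ (y = 0 /\ (x = q \/ x = - q)).
Proof.
move=> q0 /dvdzP [k ->] e.
have {}e : y * y = (1 - k * k) * (q * q).
  by apply: (addrI ((k * q) ^+ 2)); rewrite -[y * y]expr2 e; ring.
(* Nonnegativity of [y^2 = (1 - k^2) q^2] leaves only [k] in {-1, 0, 1}. *)
have hk : k * k <= 1.
  by rewrite -subr_ge0 -(pmulr_lge0 _ (mulr_gt0 q0 q0)) -e -expr2 sqr_ge0.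
have sqr0 : y * y = 0 -> y = 0 by move/eqP; rewrite mulf_eq0 orbb => /eqP.
have : -1 <= k <= 1 by rewrite -ler_norml -(@expr_le1 _ 2) // real_normK ?num_real // expr2.
have [k0|[k0|k0]] : k = 0 \/ k = 1 \/ k = -1 by lia.
- left; rewrite k0 mul0r; split=> //.
  have : (y - q) * (y + q) = 0.
    by rewrite -subr_sqr !expr2 e k0; ring.
  by move/eqP; rewrite mulf_eq0 => /orP [] /eqP h; [left|right]; lia.
- by right; rewrite sqr0 ?e k0; [split => //; left|]; ring.
- by right; rewrite sqr0 ?e k0; [split => //; right|]; ring.
Qed.

(** Brahmagupta's identity gives [(sb - ta)^2 + (sa + tb)^2 = q^2]. Once [q] divides the first term,
    one of the two vanishes, and the congruences modulo 4 exclude the wrong sign and the swapped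
    pair. *)
Lemma two_squares_unique (p n : nat) (a b s t : int) :
  prime p -> odd p -> (0 < n)%N ->
  (p ^ n)%N%:Z = a ^+ 2 + b ^+ 2 -> (p ^ n)%N%:Z = s ^+ 2 + t ^+ 2 ->
  ~~ (p%:Z %| a)%Z -> ~~ (p%:Z %| s)%Z -> (p%:Z %| s * b - t * a)%Z ->
  (a = 1 %[mod 4])%Z -> (s = 1 %[mod 4])%Z -> s = a /\ t = b.
Proof.
move=> pp op n0; set q := (p ^ n)%N%:Z => ab st na ns dst a1 s1.
have q0 : 0 < q by rewrite /q ltz_nat expn_gt0 prime_gt0.
have qodd : ~~ (2 %| q)%Z by rewrite /q dvdzE /= dvdn2 oddX op orbT.
have primeM x y : (p%:Z %| x * y)%Z = (p%:Z %| x)%Z || (p%:Z %| y)%Z.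
  by rewrite !dvdzE abszM /= Euclid_dvdM.
(* If [p] also divided [sb + ta], it would divide [2sb], hence [b], and then [a^2 = q - b^2]. *)
have nplus : ~~ (p%:Z %| s * b + t * a)%Z.
  apply/negP => h.
  have : (p%:Z %| s * b * 2)%Z.
    have -> : s * b * 2 = (s * b - t * a) + (s * b + t * a) by ring.
    exact: rpredD.
  rewrite !primeM (negPf ns) /= => /orP [pb|].
    have : (p%:Z %| a * a)%Z.
      have -> : a * a = q - b * b by rewrite ab; ring.
      apply: rpredB; last by rewrite primeM pb.
      by rewrite /q dvdzE /= dvdn_exp.
    by rewrite primeM (negPf na).
  rewrite dvdzE /= => /(dvdn_leq (isT : (0 < 2)%N)) p2.
  have := prime_gt1 pp; move: op; clear -p2; case: p p2 => [|[|[|]]] //.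
(* The product with [sb + ta] is [q(s^2 - a^2)], and the cofactor is coprime to [q]. *)
have qd : (q %| s * b - t * a)%Z.
  have : (q %| (s * b - t * a) * (s * b + t * a))%Z.
    have -> : (s * b - t * a) * (s * b + t * a) = q * (s ^+ 2 - a ^+ 2).
      rewrite [RHS](_ : _ = s ^+ 2 * (a ^+ 2 + b ^+ 2) -
                            a ^+ 2 * (s ^+ 2 + t ^+ 2)).
        by ring.
      by rewrite -ab -st; ring.
    exact: dvdz_mulr.
  rewrite Gauss_dvdzl // /q /coprimez /gcdz /= -[_ == _]/(coprime _ _).
  by rewrite coprimeXl // prime_coprime //; move: nplus; rewrite dvdzE.
have eqq : (s * b - t * a) ^+ 2 + (s * a + t * b) ^+ 2 = q ^+ 2.
    rewrite [RHS](_ : _ = (a ^+ 2 + b ^+ 2) * (s ^+ 2 + t ^+ 2)); first by ring.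
  by rewrite -ab -st expr2.
have [[h1 h2]|[h1 h2]] := sqr_sum_eq q0 qd eqq.
- have hs : s * q = a * (s * a + t * b) + b * (s * b - t * a) by rewrite ab; ring.
  have ht : t * q = b * (s * a + t * b) - a * (s * b - t * a) by rewrite ab; ring.
  rewrite h1 !mulr0 ?addr0 ?subr0 in hs ht.
  have q0' : q != 0 by rewrite gt_eqF.
  case: h2 => h2.
    by split; apply: (mulIf q0'); rewrite ?hs ?ht h2.
  have : s = - a by apply: (mulIf q0'); rewrite hs h2; ring.
  by move: a1 s1; clear; lia.
(* Here [s = b] or [s = -b], so [a] and [b] are both odd and [q] would be even. *)
- exfalso.
  have hs : s * q = b * (s * b - t * a) + a * (s * a + t * b) by rewrite ab; ring.
  rewrite h1 mulr0 addr0 in hs.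
  have q0' : q != 0 by rewrite gt_eqF.
  have bodd : (b %% 2)%Z = 1.
    case: h2 => h2.
      have : s = b by apply: (mulIf q0'); rewrite hs h2.
      by move: s1; clear; lia.
    have : s = - b by apply: (mulIf q0'); rewrite hs h2; ring.
    by move: s1; clear; lia.
  have /dvdzP [u hu] : (2 %| a + b)%Z by move: a1 bodd; clear; lia.
  move: qodd; have -> : q = 2 * (u * (a - b) + b * b) .
    by rewrite ab -[2 * _]mulrC mulrDl mulrAC -hu; ring.
  by rewrite dvdz_mulr.
Qed.

(** * A central binomial coefficient modulo p *)

(* The base-p digits of f are all (p - 1) / 4, so f + f produces no carry. *)
Lemma prime_ndvd_central_binomial (p n f : nat) :
  prime p -> (p ^ n = 4 * f + 1)%N -> (p = 1 %[mod 4])%N ->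
  ~~ (p %| 'C(2 * f, f))%N.
Proof.
move=> pp hf p1.
have p4 k : exists u, (p ^ k = 4 * u + 1)%N.
  exists (p ^ k %/ 4)%N; rewrite {1}(divn_eq (p ^ k) 4) mulnC.
  by rewrite -modnXm p1 modnXm exp1n.
(* Legendre's formula, padded with zero terms so that [(2f)!] and [f!] can be compared over one
   range. *)
have big_div c m : (c * f <= m)%N -> (0 < c)%N ->
    (\sum_(1 <= k < m.+1) (c * f) %/ p ^ k = logn p (c * f)`!)%N.
  move=> cm c0; rewrite logn_fact // (@big_cat_nat _ _ _ (c * f).+1) //=.
  rewrite [X in (_ + X)%N]big_nat_cond [X in (_ + X)%N]big1 ?addn0 //.
  move=> i /andP [/andP [hi _] _]; rewrite divn_small //.
  exact: leq_trans hi (ltnW (ltn_expl _ (prime_gt1 pp))).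
(* For [k <= n], write [p^k = 4u + 1] and [p^(n-k) = 4v + 1]; then [f = v p^k + u], and the
   remainder satisfies [cu < p^k] because [c < 4]. *)
have divf c k : (c < 4)%N -> ((c * f) %/ p ^ k = c * (f %/ p ^ k))%N.
  move=> c4; case: (leqP k n) => kn; last first.
    have hlt : (p ^ n < p ^ k)%N by rewrite ltn_exp2l ?prime_gt1.
    by rewrite !divn_small ?muln0 //; nia.
  have [u hu] := p4 k; have [v hv] := p4 (n - k)%N.
  have fE : (f = v * p ^ k + u)%N.
    have : (p ^ n = p ^ (n - k) * p ^ k)%N by rewrite -expnD subnK.
    rewrite hv hu hf; nia.
  have pk0 : (0 < p ^ k)%N by rewrite expn_gt0 prime_gt0.
  rewrite fE mulnDr mulnA !divnMDl // [(u %/ _)%N]divn_small; last by lia.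
  by rewrite divn_small ?addn0 //; nia.
have b0 : (0 < 'C(2 * f, f))%N by rewrite bin_gt0; lia.
suff : (logn p 'C(2 * f, f) = 0)%N.
  by move/eqP; rewrite eqn0Ngt logn_gt0 mem_primes pp b0.
have h : (logn p (2 * f)`! = logn p 'C(2 * f, f) + (logn p f`! + logn p f`!))%N.
  rewrite -(@bin_fact (2 * f) f); last by lia.
  have -> : (2 * f - f = f)%N by lia.
  by rewrite !lognM ?muln_gt0 ?fact_gt0.
have h2 := big_div 2 (2 * f)%N (leqnn _) isT.
have h1 := big_div 1%N (2 * f)%N; rewrite mul1n in h1.
move: h; rewrite -h2 -h1; try lia.
under eq_bigr do rewrite divf //.
by rewrite -big_distrr /= mul2n -addnn; lia.
Qed.

(** * Quartic classes and cyclotomic numbers *)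

(* The exponent of [x] to the base [w], modulo 4 (junk value at [x = 0]). *)
Definition quartic_index (F : finFieldType) (w : {unit F}) (x : F) : nat :=
  (find (fun m => val w ^+ m == x) (iota 0 #|F|) %% 4)%N.

(* The number of [x] in C_a with [x - 1] in C_b: the classical symbol (b, a). *)
Definition cyclotomic_number (F : finFieldType) (w : {unit F}) (a b : nat) : nat :=
  #|[set x : F | [&& x != 0, x != 1, quartic_index w x == a
                   & quartic_index w (x - 1) == b]]|.

Section CyclotomicNumbers.

Variables (F : finFieldType) (w : {unit F}) (f : nat).
Hypothesis hw : generator [set: {unit F}] w.
Hypothesis hF : #|F| = (4 * f + 1)%N.

Local Notation cl := (quartic_index w).
Local Notation N := (cyclotomic_number w).

Lemma gen_neq0 m : val w ^+ m != 0 :> F.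
Proof. by rewrite expf_neq0 // -unitfE (valP w). Qed.

Lemma gen_order : #[w]%g = (4 * f)%N.
Proof.
by rewrite /order -(eqP hw) card_finField_unit hF addn1.
Qed.

Lemma f_gt0 : (0 < f)%N.
Proof. by have := order_gt0 w; rewrite gen_order muln_gt0. Qed.

Lemma eq_gen_exp m k :
  (val w ^+ m == val w ^+ k :> F) = (m == k %[mod 4 * f])%N.
Proof.
by rewrite -gen_order -eq_expg_mod_order -!FinRing.val_unitX (inj_eq val_inj).
Qed.

Lemma gen_expP x : x != 0 -> exists2 m, (m < 4 * f)%N & x = val w ^+ m.
Proof.
rewrite -unitfE => ux.
have : FinRing.Unit ux \in <[w]>%g by rewrite -(eqP hw) inE.
move/cyclePmin => [m]; rewrite gen_order => ltm e; exists m => //.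
by rewrite -FinRing.val_unitX -e.
Qed.

(** The exponent returned by [find] agrees with [m] only modulo the order [4f] of [w], which is
    enough modulo 4. *)
Lemma quartic_index_exp m : cl (val w ^+ m) = (m %% 4)%N.
Proof.
rewrite /quartic_index; set P := fun _ => _.
have hP : has P (iota 0 #|F|).
  apply/hasP; exists (m %% (4 * f))%N; last by rewrite /P eq_gen_exp modn_mod.
  rewrite mem_iota add0n hF addn1 ltnS /=; apply/ltnW.
  by rewrite ltn_mod muln_gt0 f_gt0.
have := nth_find 0%N hP; rewrite nth_iota; last by rewrite has_find size_iota in hP.
rewrite /P add0n eq_gen_exp => /eqP e.
by have := congr1 (fun k => k %% 4)%N e; rewrite !modn_dvdm ?dvdn_mulr.
Qed.

Lemma quartic_index_lt x : (cl x < 4)%N.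
Proof. exact: ltn_pmod. Qed.

Lemma quartic_indexM x y : x != 0 -> y != 0 -> cl (x * y) = ((cl x + cl y) %% 4)%N.
Proof.
move=> /gen_expP [m _ ->] /gen_expP [k _ ->].
by rewrite -exprD !quartic_index_exp modnDm.
Qed.

Lemma quartic_index1 : cl (1 : F) = 0%N.
Proof. by rewrite -(expr0 (val w)) quartic_index_exp. Qed.

Lemma quartic_indexV x : x != 0 -> cl x^-1 = ((4 - cl x) %% 4)%N.
Proof.
move=> x0; have := quartic_indexM x0 (invr_neq0 x0).
rewrite divff // quartic_index1.
by have := quartic_index_lt x; have := quartic_index_lt x^-1; lia.
Qed.

(** This is a square root of 1, and it is not 1 because [2f] is not a multiple of the order [4f]. *)
Lemma gen_half : val w ^+ (2 * f) = -1 :> F.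
Proof.
have : (val w ^+ (2 * f)) ^+ 2 == 1 :> F.
  rewrite -exprM -(expr0 (val w)) eq_gen_exp (_ : (2 * f * 2 = 4 * f)%N).
    by rewrite modnn mod0n.
  by lia.
rewrite sqrf_eq1 -{1}(expr0 (val w)) eq_gen_exp mod0n modn_small; last first.
  by have := f_gt0; lia.
by have := f_gt0; case: eqP => [|_ _ /eqP] //; lia.
Qed.

Lemma mem_cyclotomic_class (i : 'I_4) x :
  (x \in cyclotomic_class w f i) = (x != 0) && (cl x == i).
Proof.
apply/imsetP/andP.
  move=> [y /imsetP [j _ ->] ->]; rewrite -exprD gen_neq0; split=> //.
  by rewrite quartic_index_exp addnC mulnC modnMDl modn_small.
move=> [/gen_expP [m ltm ->]]; rewrite quartic_index_exp => /eqP e.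
have ltj : (m %/ 4 < f)%N by lia.
exists (val w ^+ (4 * (m %/ 4))); first by apply/imsetP; exists (Ordinal ltj).
by rewrite -exprD -e addnC mulnC -divn_eq.
Qed.

Lemma card_cyclotomic_class (i : 'I_4) : #|cyclotomic_class w f i| = f.
Proof.
rewrite card_imset; last exact: mulfI (gen_neq0 i).
rewrite card_imset ?card_ord // => j k /eqP.
rewrite eq_gen_exp !modn_small ?ltn_pmul2l // eqn_pmul2l // => /eqP.
exact: val_inj.
Qed.

Let index_ord x : 'I_4 := Ordinal (quartic_index_lt x).

Lemma sum_quartic_index (V : zmodType) (phi : nat -> V) :
  \sum_(x : F | x != 0) phi (cl x) = \sum_(a < 4) phi a *+ f.
Proof.
rewrite (partition_big index_ord predT) //=; apply: eq_bigr => a _.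
rewrite -(card_cyclotomic_class a) -sumr_const; apply: eq_big => x.
  by rewrite mem_cyclotomic_class -val_eqE.
by rewrite -val_eqE /= => /andP [_ /eqP ->].
Qed.

Lemma sum_cyclotomic_number (V : zmodType) (phi : nat -> nat -> V) :
  \sum_(x : F | (x != 0) && (x != 1)) phi (cl x) (cl (x - 1)) =
  \sum_(a < 4) \sum_(b < 4) phi a b *+ N a b.
Proof.
rewrite (partition_big index_ord predT) //=; apply: eq_bigr => a _.
rewrite (partition_big (fun x => index_ord (x - 1)) predT) //=.
apply: eq_bigr => b _; rewrite -sumr_const; apply: eq_big => x.
  by rewrite inE -!val_eqE /= !andbA.
by rewrite -!val_eqE /= => /andP [/andP [_ /eqP ->] /eqP ->].
Qed.

(** The extra 1 for [a = 0] accounts for [x = 1], which lies in C_0 but is excluded from every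
    cyclotomic number. *)
Lemma cyclotomic_number_rowsum a :
  (a < 4)%N -> (\sum_(b < 4) N a b + (a == 0))%N = f.
Proof.
move=> lta; apply/eqP; rewrite -eqz_nat PoszD; apply/eqP.
have := sum_quartic_index (fun c => (c == a)%:R : int).
rewrite (bigD1 1) ?oner_neq0 //= quartic_index1.
rewrite (sum_cyclotomic_number (fun c _ => (c == a)%:R : int)).
rewrite (bigD1 (Ordinal lta)) //= [X in _ + (_ + X)]big1; last first.
  move=> i; rewrite -val_eqE /= => /negPf ->.
  by rewrite big1 // => b _; rewrite mul0rn.
rewrite [RHS](bigD1 (Ordinal lta)) //= [X in _ = _ + X]big1; last first.
  by move=> i; rewrite -val_eqE /= => /negPf ->; rewrite mul0rn.
rewrite !addr0 eqxx /= => h.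
have -> : f%:Z = 1 *+ f by rewrite natz.
rewrite -h addrC eq_sym; congr (_ + _); last by case: (0%N == a).
by rewrite -natz natr_sum; apply: eq_bigr.
Qed.

(** * The quartic Jacobi sum and its norm *)

(* Real and imaginary parts of i ^ c. *)
Definition quartic_re (c : nat) : int := nth 0 [:: 1; 0; -1; 0] c.
Definition quartic_im (c : nat) : int := nth 0 [:: 0; 1; 0; -1] c.

(** Coordinates of the quartic character chi with chi(w) = i, and its square [quad], all extended by
    0 at 0. *)
Let re (x : F) : int := if x == 0 then 0 else quartic_re (cl x).
Let im (x : F) : int := if x == 0 then 0 else quartic_im (cl x).
Let quad (x : F) : int := if x == 0 then 0 else (-1) ^+ cl x.

(* Coordinates of the sum of chi(x) rho(x - 1), for chi(w) = i and rho = chi ^ 2. *)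
Definition jacobi_re : int :=
  \sum_(a < 4) \sum_(b < 4) (quartic_re a * (-1) ^+ b) *+ N a b.
Definition jacobi_im : int :=
  \sum_(a < 4) \sum_(b < 4) (quartic_im a * (-1) ^+ b) *+ N a b.

Lemma quad_vals x y (phi : nat -> int) :
  (if x == 0 then 0 else phi (cl x)) * quad y =
  if (x != 0) && (y != 0) then phi (cl x) * (-1) ^+ cl y else 0.
Proof. by rewrite /quad; do 2![case: eqP]; rewrite ?mul0r ?mulr0. Qed.

Lemma jacobi_reE : jacobi_re = \sum_x re x * quad (x - 1).
Proof.
rewrite /jacobi_re -(sum_cyclotomic_number (fun a b => quartic_re a * (-1) ^+ b)).
by rewrite big_mkcond; apply: eq_bigr => x _; rewrite quad_vals subr_eq0.
Qed.

Lemma jacobi_imE : jacobi_im = \sum_x im x * quad (x - 1).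
Proof.
rewrite /jacobi_im -(sum_cyclotomic_number (fun a b => quartic_im a * (-1) ^+ b)).
by rewrite big_mkcond; apply: eq_bigr => x _; rewrite quad_vals subr_eq0.
Qed.

Lemma quadM x y : quad (x * y) = quad x * quad y.
Proof.
rewrite /quad mulf_eq0; case: eqP => [|/eqP x0]; first by rewrite mul0r.
case: eqP => [|/eqP y0] /=; first by rewrite mulr0.
rewrite quartic_indexM // -exprD -signr_odd -[RHS]signr_odd.
by congr (_ ^+ (nat_of_bool _)); lia.
Qed.

Lemma quad1 : quad 1 = 1.
Proof. by rewrite /quad oner_eq0 quartic_index1. Qed.

Lemma quad_sqr x : x != 0 -> quad x * quad x = 1.
Proof. by rewrite /quad => /negPf ->; rewrite -expr2 sqrr_sign. Qed.

Lemma re_div x y : re (x / y) = re x * re y + im x * im y.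
Proof.
rewrite /re /im mulf_eq0 invr_eq0.
case: eqP => [|/eqP x0]; first by rewrite !mul0r.
case: eqP => [|/eqP y0] /=; first by rewrite !mulr0.
rewrite quartic_indexM ?invr_eq0 // quartic_indexV //.
have := quartic_index_lt x; have := quartic_index_lt y.
by case: (cl x) => [|[|[|[|]]]] //; case: (cl y) => [|[|[|[|]]]].
Qed.

Lemma sum_quartic_eq0 (phi : nat -> int) (h : F -> int) :
    phi 0%N + phi 1%N + phi 2%N + phi 3%N = 0 ->
    (forall x, h x = if x == 0 then 0 else phi (cl x)) ->
  \sum_x h x = 0.
Proof.
move=> phi0 hh; rewrite (bigD1 0) //= hh eqxx add0r.
rewrite (eq_bigr (fun x => phi (cl x))) ?sum_quartic_index.
  by rewrite !big_ord_recl big_ord0 addr0 -!mulrnDl !addrA phi0 mul0rn.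
by move=> x /negPf; rewrite hh => ->.
Qed.

(** Up to a square, [(z + d) z] is [1 + d/z], and [z -> d/z] permutes the nonzero elements. What
    remains is the full sum of [quad], which is 0, without its term [quad 1 = 1]. *)
Lemma sum_quad_shift (d : F) : d != 0 -> \sum_(z | z != 0) quad (z + d) * quad z = -1.
Proof.
move=> d0; rewrite (eq_bigr (fun z => quad (1 + d / z))); last first.
  move=> z z0; rewrite -quadM.
  have -> : (z + d) * z = (1 + d / z) * (z * z) by field.
  by rewrite !quadM quad_sqr ?mulr1.
have hinj : injective (fun z : F => d / z) by move=> x y /(mulfI d0) /invr_inj.
rewrite (reindex_inj hinj) /=.
rewrite (eq_big (fun z => z != 0) (fun z => quad (1 + z))); first last.
- by move=> z _; rewrite invf_div mulrCA divff // mulr1.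
- by move=> z; rewrite mulf_eq0 invr_eq0 (negPf d0).
have : \sum_z quad (1 + z) = 0.
  rewrite -[LHS](reindex_inj (P := predT) (F := quad) (addrI (1 : F))).
  by rewrite (@sum_quartic_eq0 (fun c => (-1) ^+ c)).
by rewrite (bigD1 0) //= addr0 quad1; move=> h; apply: (addrI 1); rewrite h.
Qed.

(* Re (chi(x) conj(chi(y))) = re (x / y) turns the left-hand side into a double
   sum of re u * quad (uy - 1) * quad (y - 1), whose inner sum over y is known. *)
Lemma jacobi_norm : jacobi_re ^+ 2 + jacobi_im ^+ 2 = #|F|%:Z.
Proof.
have sqr_sum (u : F -> int) : (\sum_x u x) ^+ 2 = \sum_y \sum_x u x * u y.
  by rewrite expr2 mulr_sumr; apply: eq_bigr => y _; rewrite mulr_suml.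
rewrite jacobi_reE jacobi_imE !sqr_sum -big_split /=.
pose S u := \sum_(y | y != 0) quad (u * y - 1) * quad (y - 1).
transitivity (\sum_u re u * S u).
  transitivity (\sum_(y | y != 0) \sum_u re u * (quad (u * y - 1) * quad (y - 1))).
    rewrite [RHS]big_mkcond; apply: eq_bigr => y _; rewrite -big_split /=.
    case: eqP => [->|/eqP y0] /=.
      by rewrite big1 // => x _; rewrite /re /im eqxx !mul0r !mulr0 addr0.
    (* Substitution [u = x / y]. *)
    rewrite [RHS](reindex_inj (mulIf (invr_neq0 y0))) /=; apply: eq_bigr => x _.
    by rewrite re_div divfK //; ring.
  by rewrite exchange_big; apply: eq_bigr => u _; rewrite mulr_sumr.
have S1 : S 1 = #|F|%:Z - 2.
  rewrite /S (bigD1 1) ?oner_neq0 //= mulr1 subrr.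
  rewrite {1}/quad eqxx mul0r add0r.
  rewrite (eq_bigr (fun _ => 1)); last first.
    by move=> y /andP [_ y1]; rewrite mul1r quad_sqr // subr_eq0.
  have : \sum_(y : F) (1 : int) = #|F|%:Z by rewrite sumr_const natz.
  rewrite (bigD1 0) // (bigD1 1) ?oner_neq0 //= => <-.
  by ring.
(* With [y = z + 1], [uy - 1 = u (z + (1 - 1/u))], so the shift lemma applies; the term [y = 0],
   equal to 1, is then removed. *)
have Su u : u != 0 -> u != 1 -> S u = - quad u - 1.
  move=> u0 u1.
  have h : \sum_y quad (u * y - 1) * quad (y - 1) = - quad u.
    rewrite (reindex_inj (addIr 1)) /= (bigD1 0) //=.
    rewrite add0r subrr {2}/quad eqxx mulr0 add0r.
    rewrite (eq_bigr (fun z => quad u * (quad (z + (1 - u^-1)) * quad z))).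
      rewrite -mulr_sumr sum_quad_shift ?mulrN1 // subr_eq0 eq_sym.
      by rewrite -(inj_eq invr_inj) invrK invr1.
    move=> z _; rewrite addrK [RHS]mulrA -[in RHS]quadM.
    by congr (quad _ * _); field.
  move: h; rewrite (bigD1 0) //= mulr0 sub0r quad_sqr ?oppr_eq0 ?oner_neq0 //.
  by rewrite -/(S u) => <-; rewrite addrAC subrr add0r.
have re1 : re 1 = 1 by rewrite /re oner_eq0 quartic_index1.
have hre : \sum_x re x = 0 by rewrite (@sum_quartic_eq0 quartic_re).
have hreq : \sum_x re x * quad x = 0.
  rewrite (@sum_quartic_eq0 (fun c => quartic_re c * (-1) ^+ c)) // => x.
  by rewrite /re /quad; case: eqP; rewrite ?mul0r.
(* The sums of [re] and of [re * quad] over F vanish, so over [u != 1] each is -1, and the total is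
   [(q - 2) + 1 + 1]. *)
rewrite (bigD1 1) //= re1 S1 mul1r.
rewrite (eq_bigr (fun u => - (re u * quad u) - re u)); last first.
  move=> u u1; have [->|u0] := eqVneq u 0; first by rewrite /re eqxx !mul0r subr0 oppr0.
  by rewrite Su //; ring.
rewrite big_split /= !sumrN.
move: hre hreq; rewrite (bigD1 1) //= [in X in _ -> X -> _](bigD1 1) //=.
rewrite re1 quad1 mulr1 => h1 h2.
rewrite -[\sum_(i | i != 1) re i](addKr 1) h1 -[\sum_(i | i != 1) _](addKr 1) h2.
ring.
Qed.

End CyclotomicNumbers.

Lemma big_ord4 (R : Type) (idx : R) (op : Monoid.law idx) (h : nat -> R) :
  \big[op/idx]_(i < 4) h i = op (op (op (h 0%N) (h 1%N)) (h 2%N)) (h 3%N).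
Proof. by rewrite !big_ord_recr big_ord0 /= Monoid.mul1m. Qed.

Lemma sum_ord4x4 (h : nat -> nat -> int) :
  \sum_(a < 4) \sum_(b < 4) h a b =
  h 0%N 0%N + h 0%N 1%N + h 0%N 2%N + h 0%N 3%N +
  (h 1%N 0%N + h 1%N 1%N + h 1%N 2%N + h 1%N 3%N) +
  (h 2%N 0%N + h 2%N 1%N + h 2%N 2%N + h 2%N 3%N) +
  (h 3%N 0%N + h 3%N 1%N + h 3%N 2%N + h 3%N 3%N).
Proof. by rewrite !big_ord_recr !big_ord0 /= !add0r. Qed.

Lemma mulrn_int (x : int) n : x *+ n = x * n%:Z.
Proof. by rewrite -mulr_natr natz. Qed.

(** * The Jacobi sum evaluated inside F *)

Section OddCyclotomicNumbers.

Variables (F : finFieldType) (w : {unit F}) (f : nat).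
Hypothesis hw : generator [set: {unit F}] w.
Hypothesis hF : #|F| = (4 * f + 1)%N.

Local Notation cl := (quartic_index w).
Local Notation N := (cyclotomic_number w).
Local Notation g := (val w ^+ f : F).

Lemma gen_quarter_sqr : g ^+ 2 = -1.
Proof. by rewrite -exprM mulnC (gen_half hw hF). Qed.

(** The substitution [x -> wx] multiplies the sum by [w^m], which differs from 1. *)
Lemma sum_pow_eq0 m : ~~ (4 * f %| m)%N -> \sum_(x : F) x ^+ m = 0.
Proof.
move=> ndiv.
have h : val w ^+ m * \sum_(x : F) x ^+ m = \sum_(x : F) x ^+ m.
  rewrite mulr_sumr [RHS](reindex_inj (mulfI (gen_neq0 w 1))) /=.
  by apply: eq_bigr => x _; rewrite exprMn.
have : (val w ^+ m - 1) * \sum_(x : F) x ^+ m = 0 by rewrite mulrBl mul1r h subrr.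
move/eqP; rewrite mulf_eq0 subr_eq0 -(expr0 (val w)) (eq_gen_exp hw hF).
by rewrite mod0n -/(dvdn _ _) (negPf ndiv) => /eqP.
Qed.

Lemma sum_pow_card : \sum_(x : F) x ^+ (4 * f) = -1.
Proof.
have f0 := f_gt0 hw hF.
rewrite (bigD1 0) //= expr0n gtn_eqF ?muln_gt0 // add0r.
rewrite (eq_bigr (fun _ => 1)); last first.
  move=> x /(gen_expP hw hF) [m _ ->]; rewrite -exprM mulnC exprM.
  by rewrite -(gen_order hw hF) -FinRing.val_unitX expg_order expr1n.
(* Translation by 1 permutes F, so it does not change the sum of all elements. *)
have h : \sum_(x : F) (1 : F) = 0.
  apply: (addrI (\sum_(x : F) x)); rewrite -big_split /= addr0.
  by rewrite [RHS](reindex_inj (addIr 1)).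
by move: h; rewrite (bigD1 0) //= => h; apply: (addrI 1); rewrite h subrr.
Qed.

Lemma sum_pow_mul_pow m k :
  \sum_(x : F) x ^+ m * (x - 1) ^+ k =
  \sum_(i < k.+1) (\sum_(x : F) x ^+ (m + (k - i))) * (-1) ^+ i *+ 'C(k, i).
Proof.
under eq_bigr do rewrite exprDn mulr_sumr.
rewrite exchange_big; apply: eq_bigr => i _; rewrite mulr_suml -sumrMnl.
by apply: eq_bigr => x _; rewrite mulrnAr mulrA exprD.
Qed.

Lemma pow_quartic m : (val w ^+ m) ^+ f = g ^+ (m %% 4) :> F.
Proof.
have g4 : g ^+ 4 = 1 by rewrite (exprM _ 2 2) gen_quarter_sqr sqrrN expr1n.
by rewrite exprAC (expr_mod _ g4).
Qed.

Lemma pow_half_index x : x != 0 -> x ^+ (2 * f) = (-1) ^+ cl x.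
Proof.
move=> /(gen_expP hw hF) [m _ ->]; rewrite mulnC exprM pow_quartic.
by rewrite (quartic_index_exp hw hF) exprAC gen_quarter_sqr.
Qed.

(** Here [z] is the image of i: [k = 1] sends i to [g], and [k = 3] sends it to the conjugate root
    [-g]. The characters become the powers [kf] and [2f], whose positivity gives the value 0 at
    0. *)
Lemma jacobi_field (z : F) (k : nat) :
    (0 < k)%N -> (forall c, (c < 4)%N ->
     g ^+ (k * c) = (quartic_re c)%:~R + (quartic_im c)%:~R * z) ->
  (jacobi_re w)%:~R + (jacobi_im w)%:~R * z =
  \sum_(x : F) x ^+ (k * f) * (x - 1) ^+ (2 * f).
Proof.
move=> k0 hz; have f0 := f_gt0 hw hF.
transitivity (\sum_(x : F | (x != 0) && (x != 1))
    x ^+ (k * f) * (x - 1) ^+ (2 * f)); last first.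
  rewrite big_mkcond; apply: eq_bigr => x _.
  case: eqP => [->|_]; first by rewrite expr0n gtn_eqF ?mul0r // muln_gt0 k0.
  by case: eqP => [->|_] //; rewrite subrr expr0n gtn_eqF ?mulr0 // muln_gt0.
pose phi a b : F := g ^+ (k * a) * (-1) ^+ b.
rewrite (eq_bigr (fun x => phi (cl x) (cl (x - 1)))); last first.
  move=> x /andP [x0 x1]; rewrite /phi pow_half_index ?subr_eq0 //; congr (_ * _).
  have [m _ ->] := gen_expP hw hF x0.
  by rewrite mulnC exprM pow_quartic (quartic_index_exp hw hF) -exprM mulnC.
rewrite (sum_cyclotomic_number w phi) /jacobi_re /jacobi_im.
rewrite !rmorph_sum mulr_suml -big_split; apply: eq_bigr => a _ /=.
rewrite !rmorph_sum mulr_suml -big_split; apply: eq_bigr => b _ /=.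
rewrite /phi hz // !rmorphMn !rmorphM !rmorphXn rmorphN1 /= !mulrnAl -mulrnDl.
by congr (_ *+ _); ring.
Qed.

(* The polynomial x ^ f (x - 1) ^ (2f) has degree below q - 1. *)
Lemma jacobi_field_eq0 : (jacobi_re w)%:~R + (jacobi_im w)%:~R * g = 0.
Proof.
have f0 := f_gt0 hw hF.
rewrite (@jacobi_field g 1) //; last first.
  case=> [|[|[|[|]]]] //= _; rewrite mul1n /= ?mul0r ?add0r ?mul1r ?addr0 //.
    exact: gen_quarter_sqr.
  by rewrite exprS gen_quarter_sqr mulrC.
(* The exponents run from [f] to [3f], so none is a multiple of [4f], not even 0. *)
rewrite sum_pow_mul_pow big1 // => i _; rewrite sum_pow_eq0 ?mul0r ?mul0rn //.
apply/negP; have := ltn_ord i; rewrite ltnS => hi /dvdn_leq; lia.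
Qed.

(** The exponents now run from [3f] to [5f]; only [4f], reached at [i = f], contributes, and its
    power sum is -1. *)
Lemma jacobi_field_binomial :
  (jacobi_re w)%:~R - (jacobi_im w)%:~R * g = - (-1) ^+ f *+ 'C(2 * f, f).
Proof.
have f0 := f_gt0 hw hF.
rewrite -mulrN (@jacobi_field (- g) 3) //; last first.
  have g3 : g ^+ 3 = - g by rewrite exprS gen_quarter_sqr mulrN1.
  case=> [|[|[|[|]]]] //= _; rewrite ?muln0 ?muln1 /= ?mul0r ?add0r ?mul1r ?addr0 //.
    by rewrite exprM g3 sqrrN gen_quarter_sqr.
  by rewrite exprM g3 exprNn g3 -signr_odd rmorphN1.
have fi : (f < (2 * f).+1)%N by lia.
rewrite sum_pow_mul_pow (bigD1 (Ordinal fi)) //= [X in _ + X]big1 ?addr0; last first.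
  move=> i /eqP ni; have hi : nat_of_ord i <> f by move=> e; apply/ni/val_inj.
  rewrite sum_pow_eq0 ?mul0r ?mul0rn //.
  apply/negP => /dvdnP [[|[|k]]]; have := ltn_ord i; [lia|lia|].
  by rewrite [(k.+2 * _)%N]mulSn [(k.+1 * _)%N]mulSn; lia.
have -> : (3 * f + (2 * f - f) = 4 * f)%N by lia.
by rewrite sum_pow_card mulN1r.
Qed.

(** If [p] divided a, then a = 0 in F, so [a + bg = 0] would give [bg = 0], and [a - bg] would
    vanish although the binomial coefficient is prime to [p]. *)
Lemma jacobi_re_ndvd p n : prime p -> (p ^ n = 4 * f + 1)%N -> (p = 1 %[mod 4])%N ->
  ~~ (p%:Z %| jacobi_re w)%Z.
Proof.
move=> pp hpn p1.
have pF : p \in [pchar F] by apply: (@card_finPcharP _ p n); rewrite // hF hpn.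
apply/negP => /dvdzP [k hk].
have re0 : (jacobi_re w)%:~R = 0 :> F.
  by rewrite hk rmorphM /= -pmulrn (pcharf0 pF) mulr0.
have := jacobi_field_eq0; rewrite re0 add0r => im0.
have := jacobi_field_binomial; rewrite re0 im0 subr0 -mulr_natr.
move/esym/eqP; rewrite mulf_eq0 oppr_eq0 signr_eq0 /= -(dvdn_pcharf pF).
by apply/negP; apply: (prime_ndvd_central_binomial pp hpn).
Qed.

(** * Cyclotomic numbers of order 4 for odd f *)

Hypothesis fodd : odd f.

(** For [f] odd, [-1 = w^(2f)] lies in C_2. *)
Lemma quartic_indexN x : x != 0 -> cl (- x) = ((cl x + 2) %% 4)%N.
Proof.
move=> x0; rewrite -mulN1r (quartic_indexM hw hF) ?oppr_eq0 ?oner_neq0 //.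
by rewrite -(gen_half hw hF) (quartic_index_exp hw hF); lia.
Qed.

(** The bijection [x -> 1 - x] swaps [x] and [x - 1] up to sign, and negation shifts the class by
    2. *)
Lemma cyclotomic_number_sub1 a b : (a < 4)%N -> (b < 4)%N ->
  N a b = N ((b + 2) %% 4) ((a + 2) %% 4).
Proof.
move=> lta ltb; rewrite /cyclotomic_number -!sum1dep_card.
have inj : injective (fun x : F => 1 - x) by move=> x y /addrI /oppr_inj.
rewrite [RHS](reindex_inj inj) /=; apply: eq_bigl => x.
have -> : 1 - x - 1 = - x by rewrite addrAC subrr add0r.
rewrite subr_eq0 -[1 - x == 1]subr_eq0 addrAC subrr add0r oppr_eq0 [1 == x]eq_sym.
case: (eqVneq x 0) => [_|x0] /=; first by rewrite andbF.
case: (eqVneq x 1) => [_|x1] //=.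
rewrite -[1 - x]opprB !quartic_indexN ?subr_eq0 //.
have := quartic_index_lt w x; have := quartic_index_lt w (x - 1).
move: (cl x) (cl (x - 1)) => u v; lia.
Qed.

(** Under [x -> 1/x], [1/x - 1 = -(x - 1)/x] has class [b + 2 - a]; the 6 keeps the subtraction
    within the naturals. *)
Lemma cyclotomic_number_inv a b : (a < 4)%N -> (b < 4)%N ->
  N a b = N ((4 - a) %% 4) ((b + (6 - a)) %% 4).
Proof.
move=> lta ltb; rewrite /cyclotomic_number -!sum1dep_card.
rewrite [RHS](reindex_inj invr_inj) /=; apply: eq_bigl => x.
rewrite invr_eq0 -[x^-1 == 1](inj_eq invr_inj) invrK invr1.
case: (eqVneq x 0) => [_|x0] //=.
case: (eqVneq x 1) => [_|x1] //=.
have -> : x^-1 - 1 = - (x - 1) * x^-1 by rewrite opprB mulrBl mul1r divff.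
rewrite (quartic_indexM hw hF) ?invr_eq0 ?oppr_eq0 ?subr_eq0 //.
rewrite !(quartic_indexV hw hF) // quartic_indexN ?subr_eq0 //.
have := quartic_index_lt w x; have := quartic_index_lt w (x - 1).
move: (cl x) (cl (x - 1)) => u v; lia.
Qed.

(* The values of 16 (b, a) for f odd, with q = s ^ 2 + t ^ 2 (the classical tables
   use q = s ^ 2 + 4 t ^ 2). *)
Definition cyclotomic_table (q s t : int) (a b : nat) : int :=
  let A := q - 7 + 2 * s in
  let B := q + 1 + 2 * s - 4 * t in
  let C := q + 1 - 6 * s in
  let D := q + 1 + 2 * s + 4 * t in
  let E := q - 3 - 2 * s in
  nth 0 (nth [::] [:: [:: A; E; A; E]; [:: B; E; E; D];
                      [:: C; D; A; B]; [:: D; B; E; E]] a) b.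

(** The two symmetries leave five unknowns. Rows 0, 1 and 2 (row 3 repeats row 1) and the two Jacobi
    coordinates give five linear equations for them. *)
Lemma cyclotomic_numberE a b : (a < 4)%N -> (b < 4)%N ->
  16 * (N a b)%:Z = cyclotomic_table #|F|%:Z (jacobi_re w) (- jacobi_im w) a b.
Proof.
have h1 u v := @cyclotomic_number_sub1 u v.
have h2 u v := @cyclotomic_number_inv u v.
have r0 := cyclotomic_number_rowsum hw hF (isT : 0 < 4)%N.
have r1 := cyclotomic_number_rowsum hw hF (isT : 1 < 4)%N.
have r2 := cyclotomic_number_rowsum hw hF (isT : 2 < 4)%N.
have := h1 0%N 0%N isT isT; have := h1 0%N 1%N isT isT; have := h1 0%N 3%N isT isT.
have := h1 1%N 0%N isT isT; have := h1 1%N 1%N isT isT; have := h1 1%N 2%N isT isT.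
have := h1 1%N 3%N isT isT; have := h1 2%N 1%N isT isT; have := h1 2%N 3%N isT isT.
have := h2 0%N 0%N isT isT; have := h2 0%N 1%N isT isT.
have := h2 1%N 0%N isT isT; have := h2 1%N 1%N isT isT; have := h2 1%N 2%N isT isT.
have := h2 1%N 3%N isT isT; have := h2 2%N 1%N isT isT; have := h2 2%N 3%N isT isT.
move: r0 r1 r2; rewrite !big_ord4 /jacobi_re /jacobi_im hF.
rewrite (sum_ord4x4 (fun a b => (quartic_re a * (-1) ^+ b) *+ N a b)).
rewrite (sum_ord4x4 (fun a b => (quartic_im a * (-1) ^+ b) *+ N a b)).
rewrite /quartic_re /quartic_im /modn /= !mulrn_int.
rewrite !mul0r !mul1r !mulN1r !add0n.
move: a b => [|[|[|[|]]]] // [|[|[|[|]]]] // {h1 h2} *;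
  rewrite /cyclotomic_table /=; lia.
Qed.

(** Integrality of the entry C makes [4f + 2 - 6a] divisible by 16; for [f] odd this forces [6a = 6]
    modulo 8. *)
Lemma jacobi_re_mod4 : (jacobi_re w = 1 %[mod 4])%Z.
Proof.
have h0 := cyclotomic_numberE (isT : 2 < 4)%N (isT : 0 < 4)%N.
move: h0; rewrite /cyclotomic_table /= hF => h.
have := odd_double_half f; rewrite fodd -muln2; lia.
Qed.

End OddCyclotomicNumbers.

(** * Signed difference sets as an autocorrelation condition *)

Section GroupRing.

Variable G : finZmodType.

Lemma gr_setE (S : {set G}) x : gr_set S x = (x \in S)%:R.
Proof.
rewrite /gr_set sum_ffunE; under eq_bigr do rewrite ffunE.
case: (boolP (x \in S)) => xS.
  rewrite (bigD1 x) //= eqxx big1 ?addr0 // => g /andP [_ gx].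
  by rewrite eq_sym (negPf gx).
by rewrite big1 // => g gS; case: eqP => // e; rewrite e gS in xS.
Qed.

Lemma gr_invE (A : group_ring G) x : gr_inv A x = A (- x).
Proof.
rewrite /gr_inv sum_ffunE (bigD1 (- x)) //= big1 ?addr0 => [|g gx].
  by rewrite ffunMzE ffunE opprK eqxx intz.
rewrite ffunMzE ffunE; case: eqP => [e|_]; last by rewrite mul0rz.
by rewrite e opprK eqxx in gx.
Qed.

Lemma gr_mul_invE (A : group_ring G) y :
  gr_mul A (gr_inv A) y = \sum_g A g * A (g - y).
Proof. by rewrite ffunE; apply: eq_bigr => g _; rewrite gr_invE opprB. Qed.

(** At the identity the coefficient is the sum of the squares of [D], which is always [k]; only
    nonzero shifts carry a condition. *)
Lemma signed_difference_setP (P N : {set G}) (k : nat) (lam : rat) (D : G -> int) :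
    [disjoint P & N] -> (#|P| + #|N|)%N = k ->
    (forall x, (x \in P)%:R - (x \in N)%:R = D x) ->
  signed_difference_set P N #|G| k lam <->
  exists2 l : int, lam = l%:~R & forall y, y != 0 -> \sum_g D g * D (g - y) = l.
Proof.
move=> dPN cPN hD.
have DE x : (gr_set P - gr_set N) x = D x by rewrite !ffunE !gr_setE hD.
have D0 : \sum_g D g * D (g - 0) = k%:Z.
  rewrite (eq_bigr (fun g => (g \in P)%:R + (g \in N)%:R)) => [|g _].
    rewrite big_split /= -cPN PoszD -!natz -!sum1_card !natr_sum.
    by congr (_ + _); rewrite [RHS]big_mkcond; apply: eq_bigr => g _; case: ifP.
  rewrite subr0 -hD; case: (boolP (g \in P)) => [gP|_]; last by case: (g \in N).
  by rewrite (disjointFr dPN gP).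
rewrite /signed_difference_set; split.
  case=> _ _ _ [l -> h]; exists l => // y y0.
  have := congr1 (fun A : group_ring G => A y) h.
  rewrite gr_mul_invE; under eq_bigr do rewrite !DE.
  move=> ->; rewrite ffunE !ffunMzE gr_setE inE ffunE (negPf y0).
  by rewrite mul0rz addr0 intz.
case=> l -> h; split=> //; exists l => //; apply/ffunP => y.
rewrite gr_mul_invE; under eq_bigr do rewrite !DE.
rewrite ffunE !ffunMzE gr_setE inE ffunE !intz.
by have [->|y0] := eqVneq y 0; rewrite ?D0 ?h // ?intz ?mul0rz; ring.
Qed.

End GroupRing.

(** * Autocorrelation of functions of the quartic class *)

Section Correlation.

Variables (F : finFieldType) (w : {unit F}) (f : nat).
Hypothesis hw : generator [set: {unit F}] w.
Hypothesis hF : #|F| = (4 * f + 1)%N.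
Hypothesis fodd : odd f.

Local Notation cl := (quartic_index w).
Local Notation N := (cyclotomic_number w).

(** Substitute [g = yx]. The points [x = 0] and [x = 1] meet the special value [d0], with [-y] in
    the class of [y] shifted by 2; the remaining points are counted by cyclotomic numbers. *)
Lemma quartic_correlation (d : nat -> int) (d0 : int) (D : F -> int) y :
    (forall x, D x = if x == 0 then d0 else d (cl x)) -> y != 0 ->
  \sum_g D g * D (g - y) =
    d0 * (d (cl y) + d ((cl y + 2) %% 4)%N) +
    \sum_(a < 4) \sum_(b < 4)
      (d ((cl y + a) %% 4)%N * d ((cl y + b) %% 4)%N) *+ N a b.
Proof.
move=> hD y0; rewrite (reindex_inj (mulfI y0)) /=.
rewrite (bigD1 0) //= (bigD1 1) ?oner_neq0 //= addrA; congr (_ + _).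
  rewrite mulr0 mulr1 sub0r subrr !hD eqxx oppr_eq0 (negPf y0).
  by rewrite (quartic_indexN hw hF fodd) //; ring.
rewrite -(sum_cyclotomic_number w (fun a b =>
  d ((cl y + a) %% 4)%N * d ((cl y + b) %% 4)%N)).
apply: eq_bigr => x /andP [x0 x1].
have -> : y * x - y = y * (x - 1) by rewrite mulrBr mulr1.
by rewrite !hD !mulf_eq0 subr_eq0 (negPf y0) (negPf x0) (negPf x1)
  !(quartic_indexM hw hF) ?subr_eq0.
Qed.

Definition correlation_table (q s t : int) (d : nat -> int) (d0 : int) (m : nat) : int :=
  16 * (d0 * (d m + d ((m + 2) %% 4)%N)) +
  \sum_(a < 4) \sum_(b < 4)
    d ((m + a) %% 4)%N * d ((m + b) %% 4)%N * cyclotomic_table q s t a b.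

(** Only the class of the shift matters, so the shifts [w^m] with [m < 4] suffice; the factor 16
    clears the denominators of the cyclotomic numbers. *)
Lemma signed_difference_set_cyclotomic (P S : {set F}) (k : nat) (lam : rat)
    (l : int) (d : nat -> int) (d0 : int) :
    [disjoint P & S] -> (#|P| + #|S|)%N = k ->
    (forall x, (x \in P)%:R - (x \in S)%:R = if x == 0 then d0 else d (cl x)) ->
    lam = l%:~R ->
  signed_difference_set P S #|F| k lam <->
  forall m, (m < 4)%N ->
    correlation_table #|F|%:Z (jacobi_re w) (- jacobi_im w) d d0 m = 16 * l.
Proof.
move=> dPS cPS hD ->.
have tableE m : (m < 4)%N ->
    correlation_table #|F|%:Z (jacobi_re w) (- jacobi_im w) d d0 m =
    16 * (\sum_g (if g == 0 then d0 else d (cl g)) *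
      (if g - val w ^+ m == 0 then d0 else d (cl (g - val w ^+ m)))).
  move=> ltm.
  rewrite (quartic_correlation (d := d) (d0 := d0)
    (D := fun g => if g == 0 then d0 else d (cl g))) ?gen_neq0 //.
  rewrite (quartic_index_exp hw hF) (modn_small ltm) mulrDr; congr (_ + _).
  rewrite mulr_sumr; apply: eq_bigr => a _; rewrite mulr_sumr.
  apply: eq_bigr => b _; rewrite -(cyclotomic_numberE hw hF fodd) //.
  by rewrite mulrn_int; ring.
rewrite (signed_difference_setP _ dPS cPS hD); split.
  case=> l' /intr_inj <- h m ltm; rewrite tableE // h //.
  exact: gen_neq0.
move=> h; exists l => // y y0.
have hy := quartic_index_lt w y; have := h _ hy; rewrite tableE //.
rewrite !(quartic_correlation (d := d) (d0 := d0)
    (D := fun g => if g == 0 then d0 else d (cl g))) ?gen_neq0 //.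
rewrite (quartic_index_exp hw hF) (modn_small hy).
by move/mulfI; apply.
Qed.

End Correlation.

(** * Identification of (s, t) with the Jacobi sum *)

Lemma quartic_parameters_odd (F : finFieldType) (p n f : nat) (w : {unit F})
    (s t : int) :
    prime p -> odd p -> (p ^ n = 4 * f + 1)%N -> #|F| = (p ^ n)%N ->
    generator [set: {unit F}] w -> odd f -> quartic_parameters p n w s t ->
  s = jacobi_re w /\ t = - jacobi_im w.
Proof.
move=> pp op hpf hF hw fodd [_ h1].
have hF4 : #|F| = (4 * f + 1)%N by rewrite hF.
have f0 := f_gt0 hw hF4.
have n0 : (0 < n)%N by case: n hpf {hF h1} => // /eqP; rewrite expn0; lia.
have p1 : (p = 1 %[mod 4])%N.
  (* Odd squares are 1 modulo 8 while [q = 5] modulo 8, so [n] is odd and [p = q = 1] modulo 4. *)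
  have hp2 : (p ^ 2 = 1 %[mod 8])%N.
    rewrite -modnXm; have : (p %% 8 < 8)%N by rewrite ltn_mod.
    have : odd (p %% 8) by rewrite odd_mod.
    by case: (p %% 8)%N => [|[|[|[|[|[|[|[|]]]]]]]].
  have q8 : (p ^ n %% 8 = 5)%N.
    by rewrite hpf; have := odd_double_half f; rewrite fodd -muln2; lia.
  have q4 : (p ^ n %% 4 = 1)%N by rewrite hpf; lia.
  have hn := odd_double_half n; rewrite -mul2n in hn.
  have : odd n.
    case: (odd n) hn => //= hn; move: q8.
    by rewrite -hn expnM -modnXm hp2 modnXm exp1n.
  move=> on; move: q4; rewrite -hn on expnD expnM expn1 -modnMmr -modnXm.
  have -> : (p ^ 2 %% 4 = 1)%N by lia.
  by rewrite exp1n muln1.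
have [st ns s1 hg] := h1 p1.
have pF : p \in [pchar F] by apply: (@card_finPcharP _ p n).
have Fdvd (x : int) : x%:~R = 0 :> F -> (p%:Z %| x)%Z.
  rewrite dvdzE (dvdn_pcharf pF); case: x => m /=; first by move/eqP.
  by rewrite NegzE rmorphN => /eqP; rewrite oppr_eq0.
have gE : ((p ^ n - 1) %/ 4 = f)%N by rewrite hpf addnK mulKn.
rewrite gE in hg.
(* Division by zero yields 0, which cannot equal a power of [w]. *)
have t0 : t%:~R != 0 :> F.
  by apply/eqP => t0; move: hg; rewrite t0 invr0 mulr0 => /eqP; rewrite (negPf (gen_neq0 _ _)).
have sE : s%:~R = val w ^+ f * t%:~R :> F by rewrite hg divfK.
have re_im := jacobi_field_eq0 hw hF4.
have norm := jacobi_norm hw hF4; rewrite hF in norm.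
apply: (two_squares_unique pp op n0 _ st) => //.
- by rewrite sqrrN norm.
- exact: (jacobi_re_ndvd hw hF4 pp hpf p1).
(* In F, [s = gt] and a = -bg, so the cross difference vanishes. *)
- apply: Fdvd; rewrite rmorphB !rmorphM rmorphN /= sE.
  by move/eqP: re_im; rewrite addr_eq0 => /eqP ->; ring.
- exact: jacobi_re_mod4 hw hF4 fodd.
Qed.

(** * The three families of signed sets *)

(** The test for [i] comes first, so [j = i] is allowed; the third family uses this. *)
Definition three_valued (u v z : int) (i j c : nat) : int :=
  if c == i then u else if c == j then v else z.

Section CyclotomicSignedSets.

Variables (F : finFieldType) (w : {unit F}) (f : nat).
Hypothesis hw : generator [set: {unit F}] w.
Hypothesis hF : #|F| = (4 * f + 1)%N.

Local Notation C i := (cyclotomic_class w f i).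

Lemma cyclotomic_class_disjoint (i j : 'I_4) : i != j -> [disjoint C i & C j].
Proof.
move=> ij; rewrite -setI_eq0; apply/eqP/setP => x.
rewrite !inE !(mem_cyclotomic_class hw hF); apply/negP.
by case/andP=> /andP [_ /eqP ->] /andP [_ /eqP e]; case/eqP: ij; apply: val_inj.
Qed.

Lemma cyclotomic_class_0 (i : 'I_4) : 0 \notin C i.
Proof. by rewrite (mem_cyclotomic_class hw hF) eqxx. Qed.

Lemma card_cyclotomic_classU (i j : 'I_4) : i != j -> #|C i :|: C j| = (2 * f)%N.
Proof.
move=> ij; have := leq_card_setU (C i) (C j).
rewrite cyclotomic_class_disjoint // => [[_ /eqP ->]].
by rewrite !(card_cyclotomic_class hw hF) addnn mul2n.
Qed.

Lemma card_setU0 (A : {set F}) : 0 \notin A -> #|A :|: [set 0]| = #|A|.+1.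
Proof. by move=> nA; rewrite setUC cardsU1 nA. Qed.

(** In each family the support misses exactly one class, whence the size [3f + 1], and 0 lies in the
    negative part, whence the value -1 there. *)
Lemma signed_set1 (i j : 'I_4) : i != j ->
  let P := C i in let S := [set: F] :\: (C i :|: C j) in
  [/\ [disjoint P & S], (#|P| + #|S| = 3 * f + 1)%N &
    forall x, (x \in P)%:R - (x \in S)%:R = if x == 0 then -1 else
      three_valued 1 0 (-1) i j (quartic_index w x)].
Proof.
move=> ij /=; split.
- by rewrite -setI_eq0; apply/eqP/setP => x; rewrite !inE; case: (x \in C i).
- rewrite setTD [X in (_ + X)%N]cardsCs setCK card_cyclotomic_classU // hF.
  by rewrite (card_cyclotomic_class hw hF); lia.
move=> x; rewrite !inE !(mem_cyclotomic_class hw hF) /three_valued.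
by case: (x == 0) => //=; do 2![case: eqP => //=].
Qed.

Lemma signed_set2 (i j : 'I_4) : i != j ->
  let P := [set: F] :\: (C i :|: C j :|: [set 0]) in let S := C i :|: [set 0] in
  [/\ [disjoint P & S], (#|P| + #|S| = 3 * f + 1)%N &
    forall x, (x \in P)%:R - (x \in S)%:R = if x == 0 then -1 else
      three_valued (-1) 0 1 i j (quartic_index w x)].
Proof.
move=> ij /=; have n0 := cyclotomic_class_0; split.
- rewrite -setI_eq0; apply/eqP/setP => x; rewrite !inE.
  by case: (x \in C i) => //=; case: (x == 0); rewrite ?orbT // andbF.
- rewrite setTD [X in (X + _)%N]cardsCs setCK !card_setU0 ?inE ?(negPf (n0 _)) //.
  by rewrite card_cyclotomic_classU // hF (card_cyclotomic_class hw hF); lia.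
move=> x; rewrite !inE !(mem_cyclotomic_class hw hF) /three_valued.
by case: (x == 0) => //=; do 2![case: eqP => //=].
Qed.

Lemma signed_set3 (i : 'I_4) :
  let P := [set: F] :\: (C i :|: [set 0]) in let S := [set 0] in
  [/\ [disjoint P & S], (#|P| + #|S| = 3 * f + 1)%N &
    forall x, (x \in P)%:R - (x \in S)%:R = if x == 0 then -1 else
      three_valued 0 1 1 i i (quartic_index w x)].
Proof.
have n0 := cyclotomic_class_0 i; split.
- rewrite -setI_eq0; apply/eqP/setP => x; rewrite !inE.
  by case: (x == 0); rewrite ?orbT // andbF.
- rewrite setTD [X in (X + _)%N]cardsCs setCK !card_setU0 // cards1.
  by rewrite hF (card_cyclotomic_class hw hF); lia.
move=> x; rewrite !inE !(mem_cyclotomic_class hw hF) /three_valued.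
by case: (x == 0) => //=; case: eqP => //=.
Qed.

End CyclotomicSignedSets.

(** * Reduction to linear arithmetic *)

(* The quadratic form with matrix [cyclotomic_table q s t], with the
   contribution of the zeros of [g] and [g - y] added. *)
Definition correlation_form (q s t d0 x0 x1 x2 x3 : int) : int :=
  16 * (d0 * (x0 + x2)) +
  (q - 7 + 2 * s) * (x0 * x0 + x2 * x2 + x0 * x2) +
  (q + 1 + 2 * s - 4 * t) * (x0 * x1 + x2 * x3 + x1 * x3) +
  (q + 1 - 6 * s) * (x0 * x2) +
  (q + 1 + 2 * s + 4 * t) * (x0 * x3 + x1 * x2 + x1 * x3) +
  (q - 3 - 2 * s) * (x1 * x1 + x3 * x3 + x0 * x1 + x1 * x2 + x2 * x3 + x0 * x3).

Lemma correlation_tableE q s t d d0 m : (m < 4)%N ->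
  correlation_table q s t d d0 m =
  correlation_form q s t d0 (d m) (d ((m + 1) %% 4)%N)
    (d ((m + 2) %% 4)%N) (d ((m + 3) %% 4)%N).
Proof.
move=> ltm; rewrite /correlation_table (sum_ord4x4 (fun a b =>
  d ((m + a) %% 4)%N * d ((m + b) %% 4)%N * cyclotomic_table q s t a b)).
rewrite addn0 (modn_small ltm) /cyclotomic_table /correlation_form /=.
ring.
Qed.

Lemma ratr_quarterP (a l : int) : (a%:~R / 4%:R = l%:~R :> rat) <-> a = 4 * l.
Proof.
split=> [h|->]; last by rewrite rmorphM /= mulrC mulKf.
apply: (@intr_inj rat); rewrite rmorphM /= -h mulrCA divff ?mulr1 //.
Qed.

Lemma ord4_cases (i : 'I_4) :
  [\/ nat_of_ord i = 0%N, nat_of_ord i = 1%N, nat_of_ord i = 2%N | nat_of_ord i = 3%N].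
Proof.
by case: i => [[|[|[|[|m]]]] lm] //;
  [constructor 1 | constructor 2 | constructor 3 | constructor 4].
Qed.

Lemma forall_lt4 (P : nat -> Prop) :
  (forall m, (m < 4)%N -> P m) <-> P 0%N /\ P 1%N /\ P 2%N /\ P 3%N.
Proof.
split=> [h|[h0 [h1 [h2 h3]]] [|[|[|[|]]]]] //.
by do 3?[split]; apply: h.
Qed.

Lemma or3_iff (A B D : Prop) : [\/ A, B | D] <-> A \/ B \/ D.
Proof.
split=> [[h|h|h]|[h|[h|h]]]; first by left.
- by right; left.
- by right; right.
- by constructor 1.
- by constructor 2.
- by constructor 3.
Qed.

(** Common reduction for the three families, with lambda written [a/4]: integrality of lambda is
    equivalent to [f = 1] modulo 4, and the four shift classes rotate the values of [d]. *)
Lemma signed_difference_set_cyclotomicP (F : finFieldType) (p n f : nat)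
    (w : {unit F}) (s t : int) (P S : {set F}) (d : nat -> int) (d0 a : int)
    (Q : Prop) :
    prime p -> odd p -> (p ^ n = 4 * f + 1)%N -> #|F| = (p ^ n)%N ->
    generator [set: {unit F}] w -> quartic_parameters p n w s t ->
    [/\ [disjoint P & S], (#|P| + #|S| = 3 * f + 1)%N &
      forall x, (x \in P)%:R - (x \in S)%:R =
        if x == 0 then d0 else d (quartic_index w x)] ->
    (4 %| a)%Z = (f %% 4 == 1)%N ->
    ((f = 1 %[mod 4])%N ->
       correlation_form (4 * f%:Z + 1) s t d0 (d 0%N) (d 1%N) (d 2%N) (d 3%N) = 4 * a /\
           correlation_form (4 * f%:Z + 1) s t d0 (d 1%N) (d 2%N) (d 3%N) (d 0%N) = 4 * a /\
           correlation_form (4 * f%:Z + 1) s t d0 (d 2%N) (d 3%N) (d 0%N) (d 1%N) = 4 * a /\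
           correlation_form (4 * f%:Z + 1) s t d0 (d 3%N) (d 0%N) (d 1%N) (d 2%N) = 4 * a <-> Q) ->
  signed_difference_set P S (p ^ n)%N (3 * f + 1) (a%:~R / 4%:R) <->
  (f = 1 %[mod 4])%N /\ Q.
Proof.
move=> pp op hpf hF hw hst [dPS cPS hD] ha hQ.
have hF4 : #|F| = (4 * f + 1)%N by rewrite hF.
(* When [f] is not 1 modulo 4, lambda is not an integer and both sides fail. *)
have [f1|f1] := eqVneq (f %% 4)%N 1%N; last first.
  split=> [[_ _ _ [l /ratr_quarterP al _]]|[f1' _]]; last by rewrite f1' in f1.
  by move: ha; rewrite (negPf f1) al dvdz_mulr.
have fodd : odd f by have := odd_double_half f; move: f1; clear; lia.
have [sE tE] := quartic_parameters_odd pp op hpf hF hw fodd hst.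
have /dvdzP [l al] : (4 %| a)%Z by rewrite ha f1.
have lam : a%:~R / 4%:R = l%:~R :> rat by apply/ratr_quarterP; rewrite al mulrC.
rewrite -hF (signed_difference_set_cyclotomic hw hF4 fodd dPS cPS hD lam).
rewrite -sE -tE hF4 (_ : (4 * f + 1)%N%:Z = 4 * f%:Z + 1); last by lia.
rewrite forall_lt4 !correlation_tableE // (_ : 16 * l = 4 * a); last by lia.
by rewrite hQ //; split=> [|[]].
Qed.

Unset Implicit Arguments.

Theorem proposition5p5 (p n q f : nat) (F : finFieldType) (w : {unit F})
    (s t : int) (hp : prime p) (podd : odd p) (hq : q = (p ^ n)%N)
    (hq4 : (q = 1 %[mod 4])%N) (hqf : q = (4 * f + 1)%N) (hF : #|F| = q)
    (hw : generator [set: {unit F}] w)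
    (hst : quartic_parameters p n w s t) :
  let C (i : 'I_4) := cyclotomic_class w f i in
  [/\ forall i j : 'I_4, i != j ->
        signed_difference_set (C i) ([set: F] :\: (C i :|: C j))
          q (3 * f + 1) ((f%:R - 1) / 4%:R)
        <->
        (f = 1 %[mod 4])%N /\
        [\/ (i%:Z - j%:Z = 1 %[mod 4])%Z /\ 4 * t + 3 * s = 3,
            (i%:Z - j%:Z = 2 %[mod 4])%Z /\ s = 9 |
            (i%:Z - j%:Z = 3 %[mod 4])%Z /\ 3 * s - 4 * t = 3],
      forall i j : 'I_4, i != j ->
        signed_difference_set ([set: F] :\: (C i :|: C j :|: [set 0]))
          (C i :|: [set 0])
          q (3 * f + 1) ((f%:R - 5%:R) / 4%:R)
        <->
        (f = 1 %[mod 4])%N /\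
        [\/ (i%:Z - j%:Z = 1 %[mod 4])%Z /\ 3 * s + 4 * t = - 5,
            (i%:Z - j%:Z = 2 %[mod 4])%Z /\ s = - 15 |
            (i%:Z - j%:Z = 3 %[mod 4])%Z /\ 4 * t - 3 * s = 5] &
      forall i : 'I_4,
        signed_difference_set ([set: F] :\: (C i :|: [set 0])) [set 0]
          q (3 * f + 1) ((9%:R * f%:R - 9%:R) / 4%:R)
        <->
        (f = 1 %[mod 4])%N /\ s = - 7].
Proof.
move=> C; subst q.
have hF4 : #|F| = (4 * f + 1)%N by rewrite hF.
split=> [i j ij|i j ij|i].
- have -> : (f%:R - 1 : rat) = (f%:Z - 1)%:~R by rewrite rmorphB /= -pmulrn.
  apply: (signed_difference_set_cyclotomicP hp podd hqf hF hw hst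
           (signed_set1 hw hF4 ij)).
    by apply/idP/eqP; clear; lia.
  (* For explicit classes the values of [d] are constants, so the four equations are linear in [f],
     [s] and [t]. *)
  move=> _; move: ij; rewrite -val_eqE /= or3_iff; clear.
  case: (ord4_cases i) => ->; case: (ord4_cases j) => -> // _;
    by rewrite /three_valued [X in X <-> _]/= /correlation_form; lia.
- have -> : (f%:R - 5%:R : rat) = (f%:Z - 5)%:~R by rewrite rmorphB /= -pmulrn.
  apply: (signed_difference_set_cyclotomicP hp podd hqf hF hw hst
           (signed_set2 hw hF4 ij)).
    by apply/idP/eqP; clear; lia.
  move=> _; move: ij; rewrite -val_eqE /= or3_iff; clear.
  case: (ord4_cases i) => ->; case: (ord4_cases j) => -> // _;
    by rewrite /three_valued [X in X <-> _]/= /correlation_form; lia.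
- have -> : (9%:R * f%:R - 9%:R : rat) = (9 * f%:Z - 9)%:~R.
    by rewrite rmorphB rmorphM /= -pmulrn.
  apply: (signed_difference_set_cyclotomicP hp podd hqf hF hw hst
           (signed_set3 hw hF4 i)).
    (* The factor 9 is invertible modulo 4. *)
    by apply/idP/eqP; clear; lia.
  move=> _; clear; case: (ord4_cases i) => ->;
    by rewrite /three_valued [X in X <-> _]/= /correlation_form; lia.
Qed.
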